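(* Let $\sigma\in\mathcal{P}$ be a fixed permutation. Let $p_n$ denote the probability that $[\sigma,\tau]$ contains a non-trivial disconnected subinterval, where $\tau$ is chosen uniformly at random from $\mathcal{S}_n$. Then $\lim_{n\to\infty}p_n=1$.
   Context: $\mathcal{S}_n$ is the set of permutations of $\{1,\dots,n\}$ in one-line notation $\tau=\tau_1\tau_2\dots\tau_n$, with $|\tau|=n$. The reduction of a sequence of $k$ distinct positive integers is the permutation in $\mathcal{S}_k$ obtained by replacing the smallest entry by $1$, the second smallest by $2$, and so on. For $1\le i\le j\le n$, $\tau_{[i,j]}\in\mathcal{S}_{j-i+1}$ is the reduction of $\tau_i\dots\tau_j$. The consecutive pattern poset $\mathcal{P}$ is the set $\bigcup_{n\ge1}\mathcal{S}_n$ with $\sigma\le\tau$ iff $\sigma=\tau_{[i,j]}$ for some $i\le j$. $[\sigma,\tau]=\{\pi:\sigma\le\pi\le\tau\}$ (empty if $\sigma\not\le\tau$) and $(\sigma,\tau)=\{\pi:\sigma<\pi<\tau\}$. For $\sigma\le\tau$ the rank of $[\sigma,\tau]$ is $|\tau|-|\sigma|$. An interval $[\sigma,\tau]$ is disconnected if its order complex (the simplicial complex whose faces are the chains of $(\sigma,\tau)$) is disconnected; equivalently, the Hasse diagram of $(\sigma,\tau)$ is disconnected. A disconnected interval is non-trivial if it has rank at least $3$. A subinterval of $[\sigma,\tau]$ is an interval $[\alpha,\beta]$ with $\sigma\le\alpha\le\beta\le\tau$. *)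

(* Defs.v *)
From HB Require Import structures.
From mathcomp Require Import all_boot all_order all_fingroup all_algebra.
From mathcomp Require Import zify.
From mathcomp Require Import all_classical all_reals all_analysis.

Set Implicit Arguments.
Unset Strict Implicit.
Unset Printing Implicit Defensive.

Import Order.TTheory GRing.Theory Num.Theory.

(* The word with letters in {1, ..., n}; 'S_n itself acts on {0, ..., n-1}. *)
Definition oneline n (t : 'S_n) : seq nat := [seq (val (t i)).+1 | i <- enum 'I_n].

(* In a word with distinct letters, the letter x is the r-th smallest one
   when exactly r letters are at most x. *)
Definition reduction (s : seq nat) : seq nat :=
  [seq count (fun y => y <= x) s | x <- s].

(* The word of tau_[i+1,j+1]: positions are numbered from 0. *)
Definition window n (t : 'S_n) (i j : 'I_n) : seq nat :=
  reduction (drop i (take j.+1 (oneline t))).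

(* Permutations of positive length: the first component is the length minus
   one. *)
Definition cpp : Type := {n : nat & 'S_n.+1}.
Definition Cpp n (t : 'S_n.+1) : cpp := Tagged (fun n => 'S_n.+1) t.
Definition plen (t : cpp) : nat := (tag t).+1.
Definition pperm (t : cpp) : 'S_(plen t) := tagged t.

Definition cpp_le (s t : cpp) : bool :=
  [exists i : 'I_(plen t), exists j : 'I_(plen t),
     (i <= j) && (oneline (pperm s) == window (pperm t) i j)].

Lemma size_oneline n (t : 'S_n) : size (oneline t) = n.
Proof. by rewrite size_map size_enum_ord. Qed.

Lemma uniq_oneline n (t : 'S_n) : uniq (oneline t).
Proof.
by rewrite map_inj_uniq ?enum_uniq// => i j [] /val_inj /perm_inj.
Qed.

Lemma oneline_inj n : injective (@oneline n).
Proof.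
move=> s t st; apply/permP => i; apply/val_inj.
have /eq_in_map/(_ i) := st.
by rewrite mem_enum => /(_ isT) [].
Qed.

Lemma perm_oneline n (t : 'S_n) : perm_eq (oneline t) (iota 1 n).
Proof.
have -> : iota 1 n = [seq i.+1 | i <- iota 0 n].
  by rewrite (iotaDl 1 0 n); apply: eq_map => i; rewrite add1n.
rewrite -val_enum_ord -map_comp /oneline.
rewrite (_ : [seq _ | i <- _] = [seq (val i).+1 | i <- [seq t i | i <- enum 'I_n]]).
  apply: perm_map; apply: uniq_perm.
  - by rewrite map_inj_uniq ?enum_uniq//; exact: perm_inj.
  - exact: enum_uniq.
  - move=> i; rewrite mem_enum inE; apply/mapP; exists ((t^-1)%g i).
      by rewrite mem_enum.
    by rewrite permKV.
by rewrite -[RHS]map_comp.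
Qed.

Lemma count_leq_iota x n : count (fun y => y <= x) (iota 1 n) = minn x n.
Proof.
elim: n => [|n IH]; first by rewrite minn0.
by rewrite -[in LHS](addn1 n) iotaD count_cat IH /= addn0; case: leqP => ?; lia.
Qed.

Lemma reduction_oneline n (t : 'S_n) : reduction (oneline t) = oneline t.
Proof.
rewrite -[RHS]map_id /reduction; apply/eq_in_map => x.
rewrite (perm_mem (perm_oneline t)) mem_iota => /andP[x0 xn].
have /seq.permP -> := perm_oneline t.
by rewrite count_leq_iota; lia.
Qed.

Lemma size_reduction s : size (reduction s) = size s.
Proof. exact: size_map. Qed.

Lemma reduction_map f s : {in s &, forall x y, (f x <= f y) = (x <= y)} ->
  reduction (map f s) = reduction s.
Proof.
move=> fs; rewrite /reduction -map_comp; apply/eq_in_map => x xs /=.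
by rewrite count_map; apply: eq_in_count => y ys /=; exact: fs.
Qed.

Lemma count_leq_mono s : {in s &, forall x y,
  (count (fun z => z <= x) s <= count (fun z => z <= y) s) = (x <= y)}.
Proof.
move=> x y xs ys; have [xy|yx] := leqP x y.
  by apply: sub_count => z /= zx; exact: leq_trans xy.
apply/negbTE; rewrite -ltnNge; elim: s xs {ys} => //= z s IH.
have sub : count (fun z => z <= y) s <= count (fun z => z <= x) s.
  by apply: sub_count => w /= wy; exact: leq_trans (ltnW yx).
by rewrite inE => /predU1P[<-|/IH]; lia.
Qed.

Lemma reduction_slice s i k :
  reduction (drop i (take k (reduction s))) = reduction (drop i (take k s)).
Proof.
rewrite {2}/reduction -map_take -map_drop reduction_map// => x y xs ys.
by apply: count_leq_mono; apply: mem_take; apply: mem_drop; eassumption.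
Qed.

Lemma size_window n (t : 'S_n) (i j : 'I_n) : size (window t i j) = j.+1 - i.
Proof.
by rewrite size_reduction size_drop size_takel// size_oneline.
Qed.

Lemma cpp_leP s t : reflect
  (exists i j : 'I_(plen t), i <= j /\ oneline (pperm s) = window (pperm t) i j)
  (cpp_le s t).
Proof.
apply: (iffP existsP) => [[i /existsP[j /andP[ij /eqP e]]]|[i [j [ij e]]]].
  by exists i, j.
by exists i; apply/existsP; exists j; rewrite ij e eqxx.
Qed.

Lemma window_full n (t : 'S_n.+1) : window t ord0 ord_max = oneline t.
Proof.
by rewrite /window drop0 take_oversize ?size_oneline// reduction_oneline.
Qed.

Lemma cpp_le_refl : reflexive cpp_le.
Proof.
by move=> [n t]; apply/cpp_leP; exists ord0, ord_max; rewrite window_full.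
Qed.

Lemma cpp_le_size s t : cpp_le s t -> plen s <= plen t.
Proof.
move=> /cpp_leP[i [j [ij /(congr1 size)]]].
by rewrite size_window size_oneline => ->; have := ltn_ord j; lia.
Qed.

Lemma cpp_le_anti : antisymmetric cpp_le.
Proof.
move=> [m s] [n t] /andP[st /cpp_le_size nm].
have mn := cpp_le_size st; rewrite /plen /= in nm mn.
have e : m = n by lia.
subst n; move: st => /cpp_leP[[i ilt] [[j jlt] [/= ij e]]].
have := congr1 size e; rewrite size_window size_oneline /plen/= => ij'.
suff -> : s = t by [].
apply: oneline_inj; rewrite -[RHS]window_full [LHS]e.
by congr window; apply/val_inj => /=; move: (jlt); rewrite /plen /=; lia.
Qed.

Lemma cpp_le_trans : transitive cpp_le.
Proof.
move=> t s u /cpp_leP[i [j [ij st]]] /cpp_leP[k [l [kl tu]]].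
have sz := congr1 size tu; rewrite size_window size_oneline in sz.
have jl := ltn_ord j; have ll := ltn_ord l.
have ik : k + i < plen u by lia.
have jk : k + j < plen u by lia.
apply/cpp_leP; exists (Ordinal ik), (Ordinal jk); split; first by rewrite leq_add2l.
rewrite st /window tu /window reduction_slice; congr reduction => /=.
rewrite take_drop drop_drop take_takel; last lia.
by rewrite addnC -addnS [(j.+1 + _)%N]addnC.
Qed.

Fact cpp_display : Order.disp_t. Proof. exact: Order.Disp tt tt. Qed.
HB.instance Definition _ := Choice.on cpp.
HB.instance Definition _ := Order.Le_isPOrder.Build cpp_display cpp
  cpp_le_refl cpp_le_anti cpp_le_trans.

Local Open Scope classical_set_scope.

(* A simplicial complex is given by its set of faces. *)
Definition order_complex (s t : cpp) : set (set cpp) :=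
  [set C | C `<=` (`]s, t[) /\ total_on C (fun x y => (x <= y)%O)].

(* Some two vertices are not joined by a path along the 1-dimensional faces. *)
Definition disconnected_complex (V : eqType) (K : set (set V)) : Prop :=
  exists x y : V, [/\ K [set x], K [set y] &
    ~ exists p : seq V, path (fun u v => `[< K [set u; v] >]) x p /\ last x p = y].

Definition disconnected (s t : cpp) : Prop :=
  disconnected_complex (order_complex s t).

Definition rank (s t : cpp) : nat := plen t - plen s.

Definition has_nontrivial_disconnected_subinterval (s t : cpp) : Prop :=
  exists a b : cpp, [/\ (s <= a <= b)%O, (b <= t)%O, 3 <= rank a b
                      & disconnected a b].

(* The probability for a uniformly random element of S_{n+1}. *)
Definition prob_subinterval (R : realType) (s : cpp) (n : nat) : R :=
  (#|[pred t : 'S_n.+1 | `[< has_nontrivial_disconnected_subinterval s (Cpp t) >]]|%:R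
     / #|{: 'S_n.+1}|%:R)%R.

(* Main.v *)
Require Import Defs.
From mathcomp Require Import all_boot all_order all_fingroup all_algebra.
From mathcomp Require Import zify.
From mathcomp Require Import all_classical all_reals all_analysis.
Import Order.TTheory GRing.Theory Num.Theory.
Import numFieldNormedType.Exports.
Local Open Scope classical_set_scope.
Local Open Scope ring_scope.

Set Implicit Arguments.
Unset Strict Implicit.
Unset Printing Implicit Defensive.

(** The proof exhibits one fixed pattern [r], depending on [sigma], whose mere
    presence in [tau] creates a non-trivial disconnected interval above [sigma]
    ([exists_forcing_pattern]); with probability tending to 1 it is present in a
    long random permutation ([prob_subinterval_ge]).

    Disconnectedness comes from straddling: if [a] occurs in [b] exactly at its
    beginning and at its end, then every element strictly between [a] and [b] is
    a prefix of [b] containing [a] only at the start, or a suffix containing [a]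
    only at the end. No element of one kind is comparable with one of the other
    kind, so [a, b] is disconnected as soon as its rank is at least 2
    ([straddles_disconnected]). To get rank at least 3, [sigma] is first extended
    to a permutation [a] beginning with two ascents and a descent, so that two
    occurrences of [a] are always at distance at least 3
    ([exists_spreading_extension]). The pattern [r] is [a] followed by a raised
    copy of [a]; the factor of [r] spanned by its first two occurrences of [a]
    is straddled by [a].

    For the probability, cut the positions of [tau] into disjoint blocks of the
    length [m] of [r]. Given that the earlier blocks do not show [r], the next
    one shows it with probability at least [1 / m`!], because permuting the
    entries inside that block reaches the pattern and does not affect the other
    blocks ([card_avoiding_step]). Hence [r] is absent with probability at most
    [(1 - 1 / m`!) ^+ Q], where the number [Q] of blocks tends to infinity. *)

(** * Words and occurrences *)

(** Counting the smaller values at each place gives numbers below [m] in the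
    same relative order. Factors of a permutation, explicitly given patterns,
    and the sorting permutation of a block all come from it. *)
Lemma standardize m (h : 'I_m -> nat) : injective h ->
  exists r : 'S_m, forall i j, (r i <= r j)%N = (h i <= h j)%N.
Proof.
move=> hI; pose below i := [set j | h j < h i]%N%SET.
have lt_m i : (#|below i| < m)%N.
  rewrite -[X in (_ < X)%N]card_ord -cardsT; apply: proper_card.
  by apply/properP; split=> //; exists i; rewrite ?inE ?ltnn.
have mono i j : (h i < h j -> #|below i| < #|below j|)%N.
  move=> ij; apply: proper_card; apply/properP; split.
    by apply/fintype.subsetP => k; rewrite !inE => /ltn_trans; apply.
  by exists i; rewrite !inE ?ltnn.
have rI : injective (fun i => Ordinal (lt_m i)).
  move=> i j [] e; apply: hI; apply/eqP; rewrite eqn_leq !(leqNgt (h _)).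
  by apply/andP; split; apply/negP => /mono; rewrite e ltnn.
exists (perm rI) => i j; rewrite !permE /=.
have [ij|ji] := leqP (h i) (h j); last by apply/negbTE; rewrite -ltnNge mono.
apply/subset_leq_card/fintype.subsetP => k; rewrite !inE => ki; exact: leq_trans ij.
Qed.

(** Indexing by [nat] makes shifts of positions free of casts; positions beyond
    the end get [0], which is not a letter. *)
Definition letter (z : cpp) (p : nat) : nat := nth 0%N (oneline (pperm z)) p.

Lemma letterE (z : cpp) (i : 'I_(plen z)) : letter z i = (pperm z i).+1.
Proof. by rewrite /letter (nth_map i) ?size_enum_ord// nth_ord_enum. Qed.

Lemma letter_bounds (z : cpp) p : (p < plen z)%N -> (0 < letter z p <= plen z)%N.
Proof. by move=> pz; rewrite (letterE (Ordinal pz)) ltn_ord. Qed.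

Lemma letter_inj (z : cpp) p q :
  (p < plen z)%N -> (q < plen z)%N -> letter z p = letter z q -> p = q.
Proof.
move=> pz qz /eqP; rewrite nth_uniq ?size_oneline ?uniq_oneline//.
by move/eqP.
Qed.

Lemma oneline_mkseq (z : cpp) : oneline (pperm z) = mkseq (letter z) (plen z).
Proof.
by rewrite -{2}[plen z](size_oneline (pperm z)) mkseq_nth.
Qed.

Lemma standard_cpp l (f : nat -> nat) :
  {in gtn l.+1 &, injective f} ->
  exists2 z : cpp, plen z = l.+1 &
    {in gtn l.+1 &, forall p q, (letter z p <= letter z q)%N = (f p <= f q)%N}.
Proof.
move=> fI; have [|r rE] := @standardize l.+1 (fun i => f i).
  by move=> i j /fI e; apply/val_inj/e; exact: ltn_ord.
exists (Cpp r) => // p q; rewrite !inE => pl ql.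
by have := rE (Ordinal pl) (Ordinal ql); rewrite -2!ltnS -!(letterE (z := Cpp r)).
Qed.

(** The pattern order without reductions: comparing letters pairwise makes
    composition and cancellation of occurrences a matter of adding positions. *)
Definition occurs (s t : cpp) (i : nat) : Prop :=
  (i + plen s <= plen t)%N /\
  {in gtn (plen s) &, forall p q,
    (letter t (i + p) <= letter t (i + q))%N = (letter s p <= letter s q)%N}.

Lemma reduction_eq_order (T : eqType) (f g : T -> nat) (e : seq T) :
  {in e &, forall x y, (f x <= f y)%N = (g x <= g y)%N} ->
  reduction (map f e) = reduction (map g e).
Proof.
move=> fg; rewrite /reduction -!map_comp; apply/eq_in_map => x xe /=.
by rewrite !count_map; apply: eq_in_count => y ye /=; exact: fg.
Qed.

Lemma cpp_leE (s t : cpp) : (s <= t)%O <-> exists i, occurs s t i.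
Proof.
split.
  move=> /cpp_leP[i [j [ij st]]]; exists i.
  have jt := ltn_ord j.
  have sz : plen s = (j.+1 - i)%N.
    by have := congr1 size st; rewrite size_window size_oneline.
  split=> [|p q]; first by rewrite sz; lia.
  rewrite !inE => ps qs; rewrite /letter st /window /reduction.
  set w := drop i _.
  have szw : size w = plen s by rewrite size_drop size_takel ?size_oneline.
  rewrite !(nth_map 0%N) ?szw// count_leq_mono ?mem_nth ?szw//.
  by rewrite !nth_drop !nth_take//; lia.
move=> [i [ist ord]].
have it : (i < plen t)%N by move: ist; rewrite /plen; lia.
have jt : (i + (plen s).-1 < plen t)%N by move: ist; rewrite /plen; lia.
apply/cpp_leP; exists (Ordinal it), (Ordinal jt); split; first exact: leq_addr.
have -> : window (pperm t) (Ordinal it) (Ordinal jt) =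
    reduction (mkseq (fun p => letter t (i + p)) (plen s)).
  congr reduction; apply: (@eq_from_nth _ 0%N).
    by rewrite size_mkseq size_drop size_takel ?size_oneline// /plen/=; lia.
  move=> p; rewrite size_drop size_takel ?size_oneline//= => pj.
  have ps : (p < plen s)%N by move: pj; rewrite /plen/=; lia.
  by rewrite nth_drop nth_take ?nth_mkseq// /plen; lia.
rewrite -[LHS]reduction_oneline oneline_mkseq; apply: reduction_eq_order.
by move=> p q; rewrite !mem_iota => ps qs; rewrite ord.
Qed.

Lemma occurs_trans (s t u : cpp) i j :
  occurs s t i -> occurs t u j -> occurs s u (j + i).
Proof.
move=> [ist st] [jtu tu]; split=> [|p q]; first lia.
rewrite !inE => ps qs; rewrite -!addnA tu ?st ?inE//; lia.
Qed.

(** An occurrence inside a factor is visible from the whole word and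
    conversely; together with [occurs_trans] this lets every occurrence be
    located in the largest word at hand. *)
Lemma occurs_within (s t u : cpp) i j :
  (i + plen s <= plen t)%N -> occurs t u j -> occurs s u (j + i) ->
  occurs s t i.
Proof.
move=> ist [jtu tu] [_ su]; split=> // p q.
rewrite !inE => ps qs; rewrite -su// -!addnA tu// inE; lia.
Qed.

Lemma exists_factor (t : cpp) i l : (0 < l)%N -> (i + l <= plen t)%N ->
  exists2 z : cpp, plen z = l & occurs z t i.
Proof.
case: l => // l _ il.
have [|z zl zt] := @standard_cpp l (fun p => letter t (i + p)).
  by move=> p q; rewrite !inE => pl ql /letter_inj e; apply: (@addnI i); apply: e; lia.
exists z => //; split=> [|p q]; first by rewrite zl.
by rewrite !inE zl => pl ql; rewrite zt.
Qed.

(** * Straddled permutations *)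

Lemma occurs_lt (s t : cpp) i : occurs s t i -> (plen s < plen t)%N -> (s < t)%O.
Proof.
move=> st lt_st; rewrite lt_neqAle; apply/andP; split; last by apply/cpp_leE; exists i.
by apply/eqP => e; rewrite e ltnn in lt_st.
Qed.

(** At equal lengths the occurrence is at position [0] and can be read
    backwards. *)
Lemma plen_lt (s t : cpp) : (s < t)%O -> (plen s < plen t)%N.
Proof.
move=> lt_st; rewrite ltnNge; apply/negP => ts.
have /cpp_leE[i st] := ltW lt_st.
have i0 : i = 0%N by case: st; lia.
subst i; have tt : occurs t s 0.
  by apply: (@occurs_within _ _ t 0 0) => //; split.
have : (t <= s)%O by apply/cpp_leE; exists 0%N.
by rewrite lt_geF.
Qed.

(** The length condition says that [d] is the last possible position, so [a]
    is a prefix pattern and a suffix pattern of [b]. *)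
Definition straddles (a b : cpp) : Prop :=
  exists d, [/\ plen b = (d + plen a)%N, occurs a b 0, occurs a b d &
    forall i, occurs a b i -> i = 0%N \/ i = d].

(** A proper factor of [b] misses the first or the last letter of [b], hence
    one of the two occurrences of [a]. If [a] occurs in it at all, it is a prefix
    of [b], or a suffix of [b], with [a] only at the corresponding end. *)
Lemma straddles_unique_occurrence (a b z : cpp) : straddles a b ->
  (a < z)%O -> (z < b)%O ->
  (forall j, occurs a z j -> j = 0%N) \/
  (forall j, occurs a z j -> (0 < j)%N /\ (j + plen a)%N = plen z).
Proof.
move=> [d [bl _ _ ends]] /plen_lt az zb.
have zbl := plen_lt zb; have /cpp_leE[i zbi] := ltW zb.
case: i zbi => [|i] zbi; [left|right] => j azj;
  have [izb _] := zbi; have [jaz _] := azj;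
  have [] := ends _ (occurs_trans azj zbi); lia.
Qed.

(** Starting with [a] separates prefixes from suffixes inside the open interval.
    A prefix [z] cannot lie below a suffix [z']: its copy of [a] would have to
    be the last letters of [z'], leaving no room for the remaining letters of
    [z]. A suffix cannot lie below a prefix, since its copy of [a] would not be
    at position [0]. *)
Lemma straddles_prefix_invariant (a b z z' : cpp) : straddles a b ->
  (a < z)%O -> (z <= z')%O -> (z' < b)%O -> occurs a z 0 <-> occurs a z' 0.
Proof.
move=> ab az zz' z'b.
have /cpp_leE[k azk] := ltW az; have /cpp_leE[i [izz' zz'i]] := zz'.
have azl := plen_lt az.
have azi : occurs a z' (i + k) by apply: occurs_trans azk _.
split=> [az0|az'0].
  have azi' : occurs a z' (i + 0) by apply: occurs_trans az0 _.
  have [u|u] := straddles_unique_occurrence ab (lt_le_trans az zz') z'b.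
    by rewrite -(u _ azi').
  by have := u _ azi'; lia.
have [u|u] := straddles_unique_occurrence ab (lt_le_trans az zz') z'b.
  by have := u _ azi; case: k azk {azi} => // k _; lia.
by have := u _ az'0; lia.
Qed.

(** Deleting the last or the first letter of [b] gives one element of each
    kind; rank 2 is what makes both of them differ from [a]. *)
Lemma straddles_disconnected (a b : cpp) :
  straddles a b -> (2 <= rank a b)%N -> disconnected a b.
Proof.
move=> ab; have [d [bl ab0 abd _]] := ab; rewrite /rank bl addnK => d2.
have [||x xl xb] := @exists_factor b 0 (plen b).-1; [lia..|].
have [||y yl yb] := @exists_factor b 1 (plen b).-1; [lia..|].
have ax : occurs a x 0 by apply: (occurs_within _ xb) => //; rewrite xl; lia.
have ay : occurs a y d.-1.
  by apply: (occurs_within _ yb); rewrite ?add1n ?prednK ?yl//; lia.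
have xI : (a < x < b)%O.
  by rewrite (occurs_lt ax) ?(occurs_lt xb)//; lia.
have yI : (a < y < b)%O.
  by rewrite (occurs_lt ay) ?(occurs_lt yb)//; lia.
have vertex z : (a < z < b)%O -> order_complex a b [set z].
  move=> zI; split=> [_ -> |_ _ -> ->]; first by rewrite /= in_itv.
  by left.
exists x, y; split; [exact: vertex..|].
move=> [p [xp yE]].
suff ay0 : occurs a y 0.
  have /andP[a_y y_b] := yI.
  by have [u|u] := straddles_unique_occurrence ab a_y y_b;
    have := u _ ay; have := u _ ay0; lia.
elim: p (x) xp yE ax => [z _ <- //|v p IH z /= /andP[/asboolP[zv cmp] vp] yE az].
apply: IH vp yE _.
have /zv : [set z; v] z by left.
have /zv : [set z; v] v by right.
rewrite /= !in_itv /= => /andP[a_v v_b] /andP[a_z z_b].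
have [| |le|le] := cmp z v; [by left|by right|..].
  by apply/(straddles_prefix_invariant ab a_z le v_b).
by apply/(straddles_prefix_invariant ab a_v le z_b).
Qed.

(** * A pattern that forces disconnectedness *)

(** Two occurrences of [sigma] may be too close together to give rank 3 (every
    position is an occurrence of the permutation [1]). The remedy is a prefix
    that goes up, up, down: 1, 2, k+3, followed by [sigma] raised by 2, where k
    is the length of [sigma]. An occurrence at distance 1 or 2 from an earlier
    one would need an ascent where the earlier one has its descent. *)
Lemma exists_spreading_extension (sigma : cpp) :
  exists2 a : cpp, (sigma <= a)%O &
    forall t i j, occurs a t i -> occurs a t j -> (i < j)%N -> (i + 3 <= j)%N.
Proof.
pose k := plen sigma; have k0 : (0 < k)%N by [].
pose f p := (if p < 2 then p else if p == 2 then k.+3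
             else (letter sigma (p - 3)).+2)%N.
have [|a al af] := @standard_cpp k.+2 f.
  move=> p q; rewrite !inE /f => pk qk.
  have bound m : (1 < m)%N -> m <> 2%N -> (m < k.+3)%N ->
      (0 < letter sigma (m - 3) <= k)%N.
    by move=> *; apply: letter_bounds; rewrite -/k; lia.
  case: (ltnP p 2) => p2; case: (ltnP q 2) => q2 //;
    case: eqP => p2'; try (case: eqP => q2'); try lia.
  - by have := bound q q2 q2' qk; lia.
  - by have := bound p p2 p2' pk; lia.
  by case=> /letter_inj; rewrite -/k; lia.
exists a.
  apply/cpp_leE; exists 3%N; split; first by rewrite al.
  by move=> p q; rewrite !inE -/k => pk qk; rewrite af ?inE; [|lia..]; rewrite /f /= !addKn.
move=> t i j [_ ti] [_ tj] ij; rewrite leqNgt; apply/negP => ji.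
have cmp p q : (p <= 3)%N -> (q <= 3)%N -> (letter a p <= letter a q)%N = (f p <= f q)%N.
  by move=> p3 q3; rewrite af// inE; lia.
have f3 : (f 3 < f 2)%N by have /andP[_] := letter_bounds k0; rewrite /f /= !ltnS.
have ti' p q : (p <= 3)%N -> (q <= 3)%N ->
    (letter t (i + p) <= letter t (i + q))%N = (f p <= f q)%N.
  by move=> p3 q3; rewrite ti ?cmp// inE al; lia.
have tj' p q : (p <= 3)%N -> (q <= 3)%N ->
    (letter t (j + p) <= letter t (j + q))%N = (f p <= f q)%N.
  by move=> p3 q3; rewrite tj ?cmp// inE al; lia.
have descent : (letter t (i + 2) <= letter t (i + 3))%N = false.
  by rewrite ti' //; apply/negbTE; rewrite -ltnNge.
have [e|e] : j = (i + 1)%N \/ j = (i + 2)%N by lia.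
  by have := tj' 1%N 2%N isT isT; rewrite e -!addnA descent.
by have := tj' 0%N 1%N isT isT; rewrite e -!addnA descent.
Qed.

(** The direct sum of [a] with itself. *)
Lemma exists_two_occurrences (a : cpp) :
  exists r : cpp, occurs a r 0 /\ occurs a r (plen a).
Proof.
pose L := plen a; have L0 : (0 < L)%N by [].
have bound p : (p < L)%N -> (0 < letter a p <= L)%N by exact: letter_bounds.
pose f p := (if p < L then letter a p else L + letter a (p - L))%N.
have [|r rl rf] := @standard_cpp (L + L).-1 f.
  move=> p q; rewrite !inE prednK /f ?addn_gt0 ?L0// => pL qL.
  case: (ltnP p L) => p1; case: (ltnP q L) => q1.
  - exact: letter_inj.
  - by have := bound p p1; have := bound (q - L)%N; lia.
  - by have := bound q q1; have := bound (p - L)%N; lia.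
  by move/addnI/letter_inj; lia.
exists r; split; (split; first by [rewrite rl -/L; lia]);
  move=> p q; rewrite !inE -/L => pL qL.
  by rewrite !add0n rf ?inE; [rewrite /f pL qL|lia..].
rewrite rf ?inE; [|lia..].
by rewrite /f !ltnNge !leq_addr /= !addKn leq_add2l.
Qed.

(** In a word with at least two occurrences of the spread-out extension [a],
    the first of them at position [0], cut just after the next one: the factor
    [b] obtained is straddled by [a], and the rank of the interval is the
    distance between the two occurrences. *)
Lemma exists_forcing_pattern (sigma : cpp) : exists r : cpp,
  forall t, (r <= t)%O -> has_nontrivial_disconnected_subinterval sigma t.
Proof.
have [a sa spread] := exists_spreading_extension sigma.
have [r [ar0 arL]] := exists_two_occurrences a.
have ex : exists d, (0 < d)%N && `[< occurs a r d >].
  by exists (plen a); apply/andP; split=> //; apply/asboolP.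
have [d /andP[d0 /asboolP ard] dmin] := ex_minnP ex.
have d3 : (3 <= d)%N by exact: spread ar0 ard d0.
have [||b bl br] := @exists_factor r 0 (d + plen a).
- by rewrite addn_gt0 d0.
- by case: ard.
have ab0 : occurs a b 0 by apply: occurs_within br _; rewrite // bl leq_addl.
have abd : occurs a b d by apply: occurs_within br _; rewrite // bl.
exists r => t rt; exists a, b; split.
- by rewrite sa; apply/cpp_leE; exists 0%N.
- by apply: le_trans rt; apply/cpp_leE; exists 0%N.
- by rewrite /rank bl addnK.
apply: straddles_disconnected; last by rewrite /rank bl addnK ltnW.
exists d; split=> // i abi; have [->|i0] := posnP i; [by left|right].
have := dmin i; rewrite i0 /= => di.
have {}di : (d <= i)%N.
  by apply/di/asboolP; rewrite -[i]add0n; exact: occurs_trans abi br.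
by case: abi; rewrite bl; lia.
Qed.

(** * Avoiding a pattern on disjoint blocks *)

Definition has_pattern (N m : nat) (r : 'S_m) (f : 'I_m -> 'I_N) (t : 'S_N) : bool :=
  [forall i, forall j, (t (f i) <= t (f j))%N == (r i <= r j)%N].

(** Sorting the entries of a block and then permuting them according to [r]
    changes nothing outside the block. *)
Lemma rearrange_to_pattern N m (r : 'S_m) (f : 'I_m -> 'I_N) (t : 'S_N) :
  injective f ->
  exists2 g : 'S_N, perm_on (f @: 'I_m)%SET g & has_pattern r f (g * t)%g.
Proof.
move=> fI; have [|s sE] := @standardize m (fun i => t (f i)).
  by move=> i j e; apply/fI/(@perm_inj _ t)/val_inj.
(* The values of t o f are put in increasing order by s^-1, then in the order
   of r. *)
pose h x := if [pick i | f i == x] is Some i then f (s^-1 (r i))%g else x.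
have hf i : h (f i) = f (s^-1 (r i))%g.
  rewrite /h; case: pickP => [j /eqP/fI -> //|/(_ i)].
  by rewrite eqxx.
have hN x : x \notin (f @: 'I_m)%SET -> h x = x.
  move=> xf; rewrite /h; case: pickP => // j /eqP e.
  by rewrite -e imset_f in xf.
have hI : injective h.
  move=> x y; have [/imsetP[i _ ->]|xf] := boolP (x \in (f @: 'I_m)%SET);
    have [/imsetP[j _ ->]|yf] := boolP (y \in (f @: 'I_m)%SET).
  - by rewrite !hf => /fI/perm_inj/perm_inj ->.
  - by rewrite hf (hN y)// => e; rewrite -e imset_f in yf.
  - by rewrite hf (hN x)// => e; rewrite e imset_f in xf.
  - by rewrite !hN.
exists (perm hI).
  by apply/fintype.subsetP => x; rewrite inE permE; apply: contraNT => /hN ->.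
apply/forallP => i; apply/forallP => j.
by rewrite !permM !permE !hf -sE !permKV.
Qed.

Definition avoiding (N m Q : nat) (r : 'S_m) (f : nat -> 'I_m -> 'I_N) : {set 'S_N} :=
  [set t : 'S_N | [forall q : 'I_Q, ~~ has_pattern r (f q) t]]%SET.

(** Independence of the blocks, in the one-sided form that suffices. The [m`!]
    permutations of the positions of block [Q] leave the other blocks alone, and
    one of them creates the pattern in block [Q]. So [m`!] copies of the set of
    permutations whose first occurrence on the blocks is in block [Q] cover
    everything that avoids the pattern on the earlier blocks. *)
Lemma card_avoiding_step N m Q (r : 'S_m) (f : nat -> 'I_m -> 'I_N) :
  injective (f Q) ->
  (forall q i j, (q < Q)%N -> f q i != f Q j) ->
  (#|avoiding Q r f| <= m`! * #|avoiding Q r f :\: avoiding Q.+1 r f|)%N.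
Proof.
move=> fI disj; pose B := (f Q @: 'I_m)%SET.
have fix_below g q i : perm_on B g -> (q < Q)%N -> g (f q i) = f q i.
  move=> gB qQ; apply: out_perm gB _; apply/imsetP => -[j _ e].
  by have := disj q i j qQ; rewrite e eqxx.
have -> : m`! = #|[set g : 'S_N | perm_on B g]%SET|.
  by rewrite cardsE card_perm card_imset// card_ord.
rewrite -cardsX.
set X := finset.setX _ _.
apply: leq_trans (leq_imset_card (fun gt : 'S_N * 'S_N => (gt.1^-1 * gt.2)%g) X).
apply/subset_leq_card/fintype.subsetP => t; rewrite inE => /forallP tav.
have [g gB gt] := rearrange_to_pattern r t fI.
apply/imsetP; exists (g, (g * t)%g); last by rewrite /= mulKg.
rewrite !inE /= gB /=; apply/andP; split.
  by apply/forallPn; exists ord_max; rewrite negbK.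
apply/forallP => q; apply: contra (tav q) => /forallP gtq.
apply/forallP => i; apply/forallP => j; have /forallP/(_ j) := gtq i.
by rewrite !permM !(fix_below g q _ gB (ltn_ord q)).
Qed.

Lemma card_avoiding_le (R : realType) N m Q (r : 'S_m) (f : nat -> 'I_m -> 'I_N) :
  (forall q, (q < Q)%N -> injective (f q)) ->
  (forall q q' i j, (q < q')%N -> (q' < Q)%N -> f q i != f q' j) ->
  #|avoiding Q r f|%:R <= (1 - m`!%:R^-1) ^+ Q * N`!%:R :> R.
Proof.
elim: Q => [|Q IH] fI disj.
  rewrite expr0 mul1r ler_nat -card_Sn.
  exact: max_card.
have step := card_avoiding_step r (fI Q (ltnSn Q)) (fun q i j qQ => disj q Q i j qQ (ltnSn Q)).
have sub : (avoiding Q.+1 r f \subset avoiding Q r f).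
  apply/fintype.subsetP => t; rewrite !inE => /forallP tav; apply/forallP => q.
  exact: tav (widen_ord (leqnSn Q) q).
have fact_pos : 0 < m`!%:R :> R by rewrite ltr0n fact_gt0.
have c0 : 0 <= 1 - m`!%:R^-1 :> R.
  by rewrite subr_ge0 invf_le1// ler1n fact_gt0.
rewrite exprS -mulrA; apply: le_trans (ler_wpM2l c0 (IH _ _)); last first.
- by move=> q q' i j qq' q'Q; apply: disj => //; exact: ltnW.
- by move=> q qQ; apply: fI; exact: ltnW.
move: step; rewrite cardsD (finset.setIidPr sub) -(ler_nat R) natrM natrB ?subset_leq_card//.
rewrite mulrBl mul1r lerBrDl -lerBrDr ler_pdivrMl//.
Qed.

(** * The limit *)

Lemma has_pattern_le n (r : cpp) (q : nat) (f : 'I_(plen r) -> 'I_n.+1) (t : 'S_n.+1) :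
  (forall i, f i = (q + i)%N :> nat) -> has_pattern (pperm r) f t ->
  (r <= Cpp t)%O.
Proof.
move=> fE /forallP rt; apply/cpp_leE; exists q; split.
  by have := ltn_ord (f ord_max); rewrite fE /= /plen/=; lia.
move=> i j; rewrite !inE => ir jr.
have /forallP/(_ (Ordinal jr))/eqP := rt (Ordinal ir).
rewrite -[X in X = _]ltnS -[X in _ = X]ltnS -!(letterE (z := r)).
by rewrite -!(letterE (z := Cpp t)) !fE.
Qed.

(** The blocks are the consecutive groups of [plen r] positions; the incomplete
    group at the end is left out. *)
Lemma prob_subinterval_ge (R : realType) (sigma r : cpp) n :
  (forall t, (r <= t)%O -> has_nontrivial_disconnected_subinterval sigma t) ->
  1 - (1 - (plen r)`!%:R^-1) ^+ (n.+1 %/ plen r) <= prob_subinterval R sigma n.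
Proof.
move=> forcing; pose m := plen r; have m0 : (0 < m)%N by [].
pose f q (i : 'I_m) : 'I_n.+1 := inord (q * m + i).
have fE q i : (q < n.+1 %/ m)%N -> f q i = (q * m + i)%N :> nat.
  move=> qQ; rewrite inordK//; apply: (@leq_trans (q.+1 * m)).
    by rewrite mulSn addnC ltn_add2r.
  by rewrite -leq_divRL.
rewrite /prob_subinterval; set H := [pred t | _].
have cardS : #|{: 'S_n.+1}| = n.+1`! by rewrite card_Sn.
have Npos : 0 < n.+1`!%:R :> R by rewrite ltr0n fact_gt0.
rewrite cardS ler_pdivlMr// mulrBl mul1r lerBlDr -lerBlDl.
apply: le_trans (@card_avoiding_le R n.+1 m (n.+1 %/ m) (pperm r) f _ _).
- rewrite lerBlDl -natrD ler_nat -cardS -(cardC H) leq_add2l.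
  apply/subset_leq_card/fintype.subsetP => t; rewrite !inE => tH.
  apply/forallP => q; apply: contra tH => rt; apply/asboolP/forcing.
  by apply: has_pattern_le rt => i; exact: fE.
- move=> q qQ i j /(congr1 val); rewrite /= !fE// => /addnI; exact: val_inj.
- move=> q q' i j qq' q'Q; apply/negP => /eqP/(congr1 val) /=.
  rewrite !fE//; last exact: ltn_trans q'Q.
  have := ltn_ord i; have : (q.+1 * m <= q' * m)%N by rewrite leq_mul2r qq' orbT.
  by rewrite mulSn; lia.
Qed.

Lemma prob_subinterval_le1 (R : realType) (sigma : cpp) n :
  prob_subinterval R sigma n <= 1.
Proof.
rewrite /prob_subinterval ler_pdivrMr; first by rewrite mul1r ler_nat max_card.
by rewrite ltr0n; apply/card_gt0P; exists 1%g.
Qed.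

Theorem theorem3p6 (R : realType) (sigma : cpp) :
  prob_subinterval R sigma n @[n --> \oo] --> (1 : R).
Proof.
have [r forcing] := exists_forcing_pattern sigma.
pose c : R := 1 - (plen r)`!%:R^-1.
have c0 : 0 <= c by rewrite subr_ge0 invf_le1 ?ltr0n ?fact_gt0// ler1n fact_gt0.
have c1 : `|c| < 1.
  by rewrite ger0_norm// ltrBlDr ltrDl invr_gt0 ltr0n fact_gt0.
have blocks : (n.+1 %/ plen r)%N @[n --> \oo] --> \oo.
  apply/cvgnyPge => A; exists (A * plen r)%N => // n /= An.
  by rewrite leq_divRL//; exact: leq_trans An _.
apply: (@squeeze_cvgr _ _ _ _ (fun n => 1 - c ^+ (n.+1 %/ plen r)) (fun=> 1)).
- by apply: nearW => n; rewrite prob_subinterval_ge// prob_subinterval_le1.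
- rewrite -[X in _ --> X]subr0; apply: cvgB; first exact: cvg_cst.
  exact: cvg_comp blocks (cvg_expr c1).
- exact: cvg_cst.
Qed.
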